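(* Let $l \geq 1$ and $p_1, p_2, \ldots, p_m \geq 2$ be integers, let $n = l + \sum_{i=1}^m p_i$, and let $d \leq n-m$. Let $\Lambda = \Lambda(l;p_1,\ldots,p_m)$. If $M \subseteq S(\infty^{n-d-m}, p_1-1, p_2-1, \ldots, p_m-1)$ is a multicomplex with $\deg(M) \leq d$, then there is a $(d-1)$-dimensional shellable subcomplex $\Gamma$ of $\Lambda$ such that $h(\Gamma) = F(M)$.
   Context: $\Lambda(l;p_1,\ldots,p_m) = \Delta^{l-1} * \partial\Delta^{p_1-1} * \cdots * \partial\Delta^{p_m-1}$, where $\Delta^k$ is the $k$-simplex and $\partial \Delta^k$ its boundary complex; equivalently, it is the simplicial complex on a vertex set $V = V' \sqcup P_1 \sqcup \cdots \sqcup P_m$ with $|V'| = l$, $|P_i| = p_i$, whose faces are the subsets of $V$ containing no $P_i$. For $0 \le a_i \le \infty$, $S(a_1,\ldots,a_k)$ is the set of monomials $x_1^{c_1}\cdots x_k^{c_k}$ with $c_i \leq a_i$ for all $i$; $S(\infty^r, a_{r+1},\ldots,a_k)$ means $a_1=\cdots=a_r=\infty$. A multicomplex is a nonempty subset $M$ of such a set closed under divisibility. For finite $M$, $\deg(M)$ is the maximum total degree of its elements, and the $F$-vector is $F(M)=(F_0,F_1,\ldots)$ with $F_i$ the number of elements of $M$ of total degree $i$. The $h$-vector of a $(d-1)$-dimensional simplicial complex $\Gamma$ is $(h_0,\ldots,h_d)$ defined by $\sum_{i=0}^d h_i x^i = \sum_{i=0}^d f_{i-1} x^i (1-x)^{d-i}$,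 where $f_{i}$ is the number of $i$-dimensional faces (and $f_{-1}=1$). A $(d-1)$-dimensional complex is shellable if it is pure and its facets can be ordered $\tau_1,\ldots,\tau_r$ so that for each $1<i\le r$, the complex $\overline{\tau_i} \cap \bigcup_{j<i}\overline{\tau_j}$ is pure of dimension $d-2$, where $\overline{\tau}$ denotes the set of all subsets of $\tau$. The equality $h(\Gamma)=F(M)$ means $h_i = F_i$ for $0\le i\le d$ (with $F_i=0$ for $i>d$). *)

(* Defs.v *)
From HB Require Import structures.
From mathcomp Require Import all_boot all_order all_algebra.
From mathcomp Require Import finmap mpoly.

Set Implicit Arguments.
Unset Strict Implicit.
Unset Printing Implicit Defensive.

Import GRing.Theory.

Local Open Scope nat_scope.

Section Complexes.
Variable T : finType.
Implicit Types (G : {set {set T}}) (A B : {set T}).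

(* The empty set is a face of every complex; a vertex x : T need not be. *)
Definition is_complex G : Prop :=
  G != set0 /\ (forall A B, A \in G -> B \subset A -> B \in G).

Definition face_dim A : int := (#|A|%:Z - 1)%R.

(* cdim G + 1, as a natural number: the d of a (d-1)-dimensional complex *)
Definition rk G : nat := \max_(A in G) #|A|.

Definition cdim G : int := ((rk G)%:Z - 1)%R.

Definition facets G : {set {set T}} := [set A | maxset (fun B => B \in G) A].

Definition pure G : Prop := forall A, A \in facets G -> face_dim A = cdim G.

Definition shellable G : Prop :=
  pure G /\
  exists tau : seq {set T},
    [/\ uniq tau, tau =i facets G
      & forall i, 0 < i < size tau ->
          let D := powerset (nth set0 tau i)
                   :&: \bigcup_(j < i) powerset (nth set0 tau j) in
          pure D /\ cdim D = (cdim G - 1)%R].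

(* f_{i-1}, the number of (i-1)-dimensional faces *)
Definition fpred G (i : nat) : nat := #|[set A in G | #|A| == i]|.

Definition hpoly G : {poly int} :=
  (\sum_(i < (rk G).+1) (fpred G i)%:R *: ('X^i * (1 - 'X) ^+ (rk G - i)))%R.

Definition hvec G (i : nat) : int := ((hpoly G)`_i)%R.

(* The join of G1 and G2, which are meant to have disjoint vertex sets. *)
Definition cjoin G1 G2 : {set {set T}} := [set A :|: B | A in G1, B in G2].

Definition simplex A : {set {set T}} := powerset A.

(* the boundary complex of the simplex on A *)
Definition bsimplex A : {set {set T}} := powerset A :\ A.

End Complexes.

Section Lambda.
Variables (l m : nat) (p : 'I_m -> nat).

Definition vertex : finType := ('I_l + {i : 'I_m & 'I_(p i)})%type.

Definition V0 : {set vertex} := [set v | if v is inl _ then true else false].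

Definition Pset (i : 'I_m) : {set vertex} :=
  [set v | if v is inr u then tag u == i else false].

Definition Lambda : {set {set vertex}} :=
  cjoin (simplex V0) (\big[@cjoin _/[set set0]]_(i < m) bsimplex (Pset i)).

Lemma card_V0 : #|V0| = l.
Proof.
have -> : V0 = [set inl x | x in [set: 'I_l]].
  apply/setP=> -[x|x]; rewrite inE; apply/esym/imsetP.
    by exists x; rewrite ?inE.
  by case.
by rewrite card_imset ?cardsT ?card_ord // => x y [].
Qed.

Lemma card_Pset i : #|Pset i| = p i.
Proof.
pose f (x : 'I_(p i)) : vertex := inr (Tagged (fun i => 'I_(p i)) x).
have -> : Pset i = [set f x | x in [set: 'I_(p i)]].
  apply/setP=> -[x|[j x]]; rewrite inE; apply/esym.
    by apply/imsetP; case.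
  case: eqP => [/= e|ne]; last by apply/imsetP=> -[y _ e]; apply: ne; case: e.
  by apply/imsetP; rewrite -e in f *; exists x; rewrite ?inE.
rewrite card_imset ?cardsT ?card_ord // => x y [] /eqP.
by rewrite -tag_eqE /tag_eq eqxx /= tagged_asE => /eqP.
Qed.

Lemma LambdaE A : (A \in Lambda) = [forall i, ~~ (Pset i \subset A)].
Proof.
have big_joinP (r : seq 'I_m) (B : {set vertex}) : uniq r ->
    (B \in \big[@cjoin _/[set set0]]_(i <- r) bsimplex (Pset i)) =
    (B \subset \bigcup_(i <- r) Pset i) && all (fun i => ~~ (Pset i \subset B)) r.
  elim: r B => [|i r IH] B; first by rewrite !big_nil inE subset0 andbT.
  rewrite /= !big_cons => /andP[ir ur].
  have disj v j : v \in Pset i -> j \in r -> v \notin Pset j.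
    case: v => [x|u]; rewrite !inE // => /eqP e jr.
    by apply: contraNN ir; rewrite -e => /eqP ->.
  have disjU v : v \in Pset i -> v \notin \bigcup_(j <- r) Pset j.
    move=> vi; rewrite big_seq.
    apply: (big_ind (fun X : {set vertex} => v \notin X)) => [|X Y|j].
    - by rewrite inE.
    - by rewrite inE negb_or => -> ->.
    - exact: disj.
  apply/imset2P/andP => [[C D]|[sB /andP[nB aB]]].
    rewrite !inE IH // => /andP[CP sC] /andP[sD aD] ->{B}; split.
      by rewrite setUSS.
    apply/andP; split.
      apply: contraNN CP => sP; rewrite eqEsubset sC /=; apply/subsetP=> v vi.
      move/subsetP: sP => /(_ v vi); rewrite inE => /orP[//|vD].
      by case/negP: (disjU v vi); apply: (subsetP sD).
    apply/allP=> j jr; move/allP: aD => /(_ j jr).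
    apply: contraNN => /subsetP sP; apply/subsetP=> v vj.
    move: (sP v vj); rewrite inE => /orP[vC|//].
    by move: (disj v j (subsetP sC v vC) jr); rewrite vj.
  exists (B :&: Pset i) (B :\: Pset i); last by rewrite setID.
    rewrite !inE subsetIr andbT; apply: contraNN nB => /eqP e.
    by rewrite -{1}e subsetIl.
  rewrite IH //; apply/andP; split; first by rewrite subDset.
  apply/allP=> j jr; apply: contraNN (allP aB j jr) => sP.
  exact: subset_trans sP (subsetDl _ _).
apply/imset2P/forallP => [[C D]|nA].
  rewrite inE big_joinP ?index_enum_uniq // => sC /andP[sD aD] -> i.
  move/allP: aD => /(_ i (mem_index_enum i)).
  apply: contraNN => /subsetP sP; apply/subsetP=> v vi.
  move: (sP v vi); rewrite inE => /orP[/(subsetP sC)|//].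
  by case: v vi => ?; rewrite !inE.
exists (A :&: V0) (A :\: V0); last by rewrite setID.
  by rewrite inE subsetIr.
rewrite big_joinP ?index_enum_uniq //; apply/andP; split.
  apply/subsetP=> -[x|u]; rewrite !inE //= => _.
  by apply/bigcupP; exists (tag u); rewrite ?inE.
apply/allP=> i _; apply: contraNN (nA i) => sP.
exact: subset_trans sP (subsetDl _ _).
Qed.

End Lambda.

Section Multicomplexes.
Variable k : nat.
Implicit Types (a : 'I_k -> option nat) (M : {fset 'X_{1..k}}).

(* S(a_1, ..., a_k), where None stands for infinity *)
Definition Smon a : pred 'X_{1..k} :=
  fun x => [forall i, if a i is Some b then x i <= b else true].

Definition multicomplex a M : Prop :=
  [/\ M != fset0, {subset M <= Smon a}
    & forall x y, x \in M -> (y <= x)%MM -> y \in M].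

Definition deg M : nat := \max_(x <- enum_fset M) mdeg x.

Definition Fvec M (i : nat) : nat := #|` [fset x in M | mdeg x == i]%fset|.

End Multicomplexes.

(* The sequence of bounds (infinity^r, b_1, ..., b_m) *)
Definition inf_then (r m : nat) (b : 'I_m -> nat) : 'I_(r + m) -> option nat :=
  fun i => match split i with inl _ => None | inr j => Some (b j) end.

(* Main.v *)
Require Import Defs.
From HB Require Import structures.
From mathcomp Require Import all_boot all_order all_algebra.
From mathcomp Require Import finmap mpoly.
From mathcomp Require Import zify.

(* First M is replaced by a multicomplex with the same F-vector which is stable:
   if x_u divides x in M then x * x_v / x_u is in M, whenever x_v is unbounded
   and either x_u is bounded or u < v.  This is achieved by compressing M in two
   variables at a time as long as a weight decreases.

   Next, fix a linear order on the vertices.  Let F be a d-element face of Lambda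
   and E its complement, so that |E| = r + m with r = n - d - m, and E meets every P_i.
   Give to F the monomial in which the exponent of the i-th bounded variable is
   the number of elements of P_i before the first element of E in P_i, and in
   which, the m first elements of E in the P_i and the vertices counted so far
   being discarded, the exponents of the r unbounded variables are the lengths
   of the gaps between successive remaining elements of E.  This is a bijection
   from these faces onto the monomials of degree at most d within the bounds.

   Let R(F) be the set of the vertices of F counted by its monomial.  Exchanging
   v in R(F) with the element w of E that ends the gap of v replaces variables by
   later unbounded ones, or deletes them, so stability keeps the monomial in M;
   hence the lexicographic order on the faces with monomial in M is a shelling
   with restriction map R, and h_i counts the monomials of degree i in M. *)

Set Implicit Arguments.
Unset Strict Implicit.
Unset Printing Implicit Defensive.
Import GRing.Theory.

(** * Counting in lists and in initial segments of the naturals *)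

Lemma leq_in_count (T : eqType) (p q : pred T) (s : seq T) :
  {in s, subpred p q} -> count p s <= count q s.
Proof.
move=> pq; rewrite (eq_in_count (a2 := predI p q)) //.
  by apply: sub_count => x /andP[].
by move=> x /pq /=; case: (p x) => // ->.
Qed.

Section Counting.
Implicit Types (p q : pred nat) (n c : nat).

Lemma count_iota_le p n : count p (iota 0 n) <= n.
Proof. by rewrite -[leqRHS](size_iota 0) count_size. Qed.

Lemma count_iotaS p n : count p (iota 0 n.+1) = count p (iota 0 n) + p n.
Proof. by rewrite -addn1 iotaD count_cat /= add0n addn0. Qed.

Lemma count_iota_mono p m n :
  m <= n -> count p (iota 0 m) <= count p (iota 0 n).
Proof. by move=> /subnKC <-; rewrite iotaD count_cat leq_addr. Qed.

Lemma count_iota_lt p m n :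
  m < n -> p m -> count p (iota 0 m) < count p (iota 0 n).
Proof.
by move=> /(count_iota_mono p) /[swap] pm; rewrite count_iotaS pm addn1.
Qed.

Lemma count_iota_inj p m n : p m -> p n ->
  count p (iota 0 m) = count p (iota 0 n) -> m = n.
Proof.
move=> pm pn e; case: (ltngtP m n) => // h.
  by have := count_iota_lt h pm; rewrite e ltnn.
by have := count_iota_lt h pn; rewrite e ltnn.
Qed.

Lemma count_iota_surj p n c : c < count p (iota 0 n) ->
  exists2 b, b < n & p b /\ count p (iota 0 b) = c.
Proof.
elim: n => [|n IH] //; rewrite count_iotaS => h.
have [hc|hc] := ltnP c (count p (iota 0 n)).
  by have [b bn ?] := IH hc; exists b => //; exact: ltnW.
exists n => //; move: h hc; case: (p n) => /=; lia.
Qed.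

Lemma count_iota_full p n :
  count p (iota 0 n) = n -> forall c, c < n -> p c.
Proof.
move=> h c cn; have: all p (iota 0 n) by rewrite all_count h size_iota.
by move/allP; apply; rewrite mem_iota.
Qed.

(* If q fails at c0 then p fails on the window [c0, c0 + t]; deleting that
   window injects p's points below c0 as they are, and those above it after a
   shift by t. *)
Lemma count_iota_shrink p q s t b :
  (forall c c', p c -> c < (s + t).+1 -> c' <= c -> c <= c' + t -> c' <= s ->
     q c') ->
  b <= s -> b < count p (iota 0 (s + t).+1) -> b < count q (iota 0 s.+1).
Proof.
move=> pq bs hb; have [qall|nall] := boolP (all q (iota 0 s.+1)).
  by move: qall; rewrite all_count => /eqP ->; rewrite size_iota.
have [c0 c0s nq] : exists2 c0 : nat, c0 <= s & ~~ q c0.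
  have [c0 c0s nq] := allPn nall; exists c0 => //.
  by move: c0s; rewrite mem_iota.
have window c : p c -> c0 <= c < c0 + t.+1 -> False.
  by move=> pc h; move: nq; rewrite (pq c) //; lia.
suff: count p (iota 0 (s + t).+1) <= count q (iota 0 s.+1) by exact: leq_trans.
have split3 e f : iota 0 (c0 + (e + f)) =
    iota 0 c0 ++ iota c0 e ++ iota (c0 + e) f by rewrite !iotaD.
have -> : (s + t).+1 = c0 + (t.+1 + (s - c0)) by lia.
have -> : s.+1 = c0 + (1 + (s - c0)) by lia.
rewrite !split3 addn1.
rewrite !count_cat; apply: leq_add.
  apply: leq_in_count => c; rewrite mem_iota add0n => /andP[_ cc0] pc.
  apply: (pq c) => //; lia.
have -> : count p (iota c0 t.+1) = 0.
  apply/eqP; rewrite -leqn0 leqNgt -has_count; apply/hasPn => c.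
  rewrite mem_iota => hc; apply/negP => pc.
  exact: window pc hc.
rewrite add0n; apply: leq_trans (leq_addl _ _).
have -> : iota (c0 + t.+1) (s - c0) = map (addn t) (iota c0.+1 (s - c0)).
  rewrite -iotaDl; congr iota; lia.
rewrite count_map; apply: leq_in_count => c.
rewrite mem_iota => hc pc; apply: (pq (t + c)) => //; lia.
Qed.

End Counting.

(** * Compression in two variables *)

Section Compression.
Variables (k : nat) (u v : 'I_k).
Hypothesis uv : u != v.
Implicit Types (x y : 'X_{1..k}) (M : {fset 'X_{1..k}}) (c : nat).

(** For [c <= x u + x v] these are the monomials with the degree of [x] and its exponents outside
    [u] and [v]; beyond that the subtraction truncates, hence the bounds on [c] below. *)
Definition move x c : 'X_{1..k} :=
  [multinom if i == u then c else if i == v then x u + x v - c else x i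
     | i < k].

Lemma move_u x c : move x c u = c.
Proof. by rewrite mnmE eqxx. Qed.

Lemma move_v x c : move x c v = x u + x v - c.
Proof. by rewrite mnmE eqxx eq_sym (negPf uv). Qed.

Lemma move_out x c i : i != u -> i != v -> move x c i = x i.
Proof. by rewrite mnmE => /negPf -> /negPf ->. Qed.

Lemma mnm_eq_uv x y : x u = y u -> x v = y v ->
  (forall i, i != u -> i != v -> x i = y i) -> x = y.
Proof.
move=> eu ev eo; apply/mnmP => i.
by have [->|iu] := eqVneq i u; last have [->|iv] := eqVneq i v; auto.
Qed.

Lemma move_id x : move x (x u) = x.
Proof.
apply: mnm_eq_uv => [||i *]; rewrite ?move_u ?move_v ?addKn //.
exact: move_out.
Qed.

Lemma move_move x c c' : c <= x u + x v -> move (move x c) c' = move x c'.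
Proof.
move=> h; apply: mnm_eq_uv => [||i *]; rewrite ?move_v ?move_u ?move_out //.
by rewrite subnKC.
Qed.

(** Constant [w] gives invariance of the degree; a weight [w] gives the gain made by a
    compression. *)
Lemma sum_move (w : 'I_k -> nat) x c : c <= x u ->
  \sum_i w i * move x c i + w u * (x u - c)
  = \sum_i w i * x i + w v * (x u - c).
Proof.
move=> cx; have vu : v != u by rewrite eq_sym.
rewrite (bigD1 u) //= (bigD1 v) //= [in RHS](bigD1 u) //= [in RHS](bigD1 v) //=.
rewrite move_u move_v.
under eq_bigr => i /andP[iu iv] do rewrite (move_out _ _ iu iv).
have -> : x u + x v - c = (x u - c) + x v by lia.
have : w u * x u = w u * c + w u * (x u - c) by rewrite -mulnDr subnKC.
rewrite mulnDr; lia.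
Qed.

Lemma mdeg_move x c : c <= x u -> mdeg (move x c) = mdeg x.
Proof.
move=> /(sum_move (fun=> 1)) /addIn; rewrite !mdegE.
by under eq_bigr do rewrite mul1n; under [RHS]eq_bigr do rewrite mul1n.
Qed.

Definition slice M x : pred nat := fun c => move x c \in M.

Lemma slice_move M x c : c <= x u + x v -> slice M (move x c) =1 slice M x.
Proof. by move=> h c'; rewrite /slice move_move. Qed.

Definition slice_size M x := count (slice M x) (iota 0 (x u + x v).+1).

Definition mrank M x := count (slice M x) (iota 0 (x u)).

Definition squash M x := move x (mrank M x).

(* In every slice (all exponents but those of u and v fixed, and the degree
   fixed), the monomials of M are replaced by as many ones with the smallest
   exponents of u. *)
Definition compress M := [fset squash M x | x in M]%fset.

Lemma mrank_le M x : mrank M x <= x u.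
Proof. exact: count_iota_le. Qed.

Lemma slice_size_move M x c : c <= x u + x v ->
  slice_size M (move x c) = slice_size M x.
Proof.
move=> h; rewrite /slice_size move_u move_v subnKC //.
by rewrite (eq_count (slice_move M h)).
Qed.

(** The ranks of the members of [M] in a slice are [0, 1, ...] without gaps. *)
Lemma mem_compress M y :
  (y \in compress M) = (y u < slice_size M y).
Proof.
apply/idP/idP => [/imfsetP[x /= xM ->]|/count_iota_surj[b hb [bM e]]].
  have h : mrank M x <= x u + x v.
    by apply: leq_trans (mrank_le M x) (leq_addr _ _).
  rewrite /squash slice_size_move // move_u count_iota_lt //.
    by rewrite ltnS leq_addr.
  by rewrite /slice move_id.
apply/imfsetP; exists (move y b) => //=.
rewrite /squash /mrank (eq_count (slice_move _ _)) // move_u e.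
by rewrite move_move // move_id.
Qed.

(** The image determines the slice and the rank in it, and distinct members of [M] in one slice have
    distinct ranks. *)
Lemma squash_inj M : {in M &, injective (squash M)}.
Proof.
move=> x y xM yM e.
have eu : mrank M x = mrank M y by move/mnmP/(_ u): e; rewrite !move_u.
have lx := mrank_le M x; have ly := mrank_le M y.
have es : x u + x v = y u + y v.
  by move/mnmP/(_ v): e; rewrite !move_v eu; lia.
have eo i : i != u -> i != v -> x i = y i.
  by move=> iu iv; move/mnmP/(_ i): e; rewrite !move_out.
have ex : y = move x (y u).
  apply: mnm_eq_uv => [||i iu iv]; rewrite ?move_u ?move_v ?move_out //; first lia.
  by rewrite eo.
have exy : x u = y u.
  apply: (@count_iota_inj (slice M x)).
  - by rewrite /slice move_id.
  - by rewrite /slice -ex.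
  rewrite [LHS]eu /mrank; apply: eq_count.
  by rewrite {1}ex; apply: slice_move; lia.
by rewrite ex -exy move_id.
Qed.

Lemma Fvec_compress M i : Fvec (compress M) i = Fvec M i.
Proof.
rewrite /Fvec.
have -> : [fset x in compress M | mdeg x == i]%fset =
    [fset squash M x | x in [fset x in M | mdeg x == i]]%fset.
  apply/fsetP => y; rewrite !inE /=; apply/andP/imfsetP.
    case=> /imfsetP[x /= xM ->]; rewrite mdeg_move ?mrank_le // => h.
    by exists x => //=; rewrite !inE xM.
  case=> x /=; rewrite !inE /= => /andP[xM h] ->.
  by rewrite mdeg_move ?mrank_le // h; split=> //; apply/imfsetP; exists x.
apply: card_in_imfset => x y; rewrite /= !inE => /andP[xM _] /andP[yM _].
exact: squash_inj.
Qed.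

Lemma multicomplex_compress (a : 'I_k -> option nat) M :
  a v = None -> multicomplex a M -> multicomplex a (compress M).
Proof.
move=> av [M0 Ma Mdiv]; split.
- have /fset0Pn[x xM] := M0; apply/fset0Pn; exists (squash M x).
  by apply/imfsetP; exists x.
- move=> y /imfsetP[x /= xM ->]; have /forallP xa := Ma x xM.
  apply/forallP => i; have := xa i; case e: (a i) => [b|//].
  have iv : i != v by apply: contra_eq_neq e => ->; rewrite av.
  have [->|iu] := eqVneq i u; last by rewrite /squash move_out.
  by rewrite /squash move_u; apply: leq_trans (mrank_le _ _).
move=> y z; rewrite !mem_compress /slice_size => hy /mnm_lepP zy.
have [zu zv] := (zy u, zy v).
set t := (y u + y v) - (z u + z v).
have est : y u + y v = z u + z v + t by rewrite /t; lia.
apply: (@count_iota_shrink (slice M y) _ _ t); rewrite ?leq_addr -?est //; last lia.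
(* [move z c'] divides [move y c] because [c' <= c <= c' + t], where [t] is the degree lost in [u]
   and [v] from [y] to [z]. *)
move=> c c' cM cl c'c cc' c's; apply: (Mdiv _ _ cM).
apply/mnm_lepP => i; have [->|iu] := eqVneq i u; first by rewrite !move_u.
have [->|iv] := eqVneq i v; first by rewrite !move_v; lia.
by rewrite !move_out.
Qed.

End Compression.

(** * Stable multicomplexes, by descent on a total weight *)

Section Stable.
Variables (k : nat) (a : 'I_k -> option nat) (w : 'I_k -> nat).
Implicit Types (x : 'X_{1..k}) (M : {fset 'X_{1..k}}).

Definition admissible (u v : 'I_k) := (a v == None) && (w v < w u).

Definition stable M := forall u v, admissible u v ->
  forall x, x \in M -> 0 < x u -> move u v x (x u).-1 \in M.

Lemma exists_stable M : multicomplex a M -> exists M',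
  [/\ multicomplex a M', Fvec M' =1 Fvec M & stable M'].
Proof.
pose W x := \sum_i w i * x i.
have [n] := ubnP (\sum_(x <- M) W x); elim: n M => // n IH M ltn hM.
have [/forallP st|/forallPn[u /forallPn[v]]] := boolP [forall u, forall v,
  admissible u v ==> all (fun x => (0 < x u) ==> (move u v x (x u).-1 \in M)) M].
  exists M; split=> // u v uv x xM x0.
  move/forallP/(_ v): (st u); rewrite uv /= => /allP/(_ x xM).
  by rewrite x0.
rewrite negb_imply => /andP[adm /allPn[x xM]].
have [/eqP av wuv] := andP adm.
have uv : u != v by apply: contraTneq wuv => ->; rewrite ltnn.
rewrite negb_imply => /andP[x0 xN].
have le_W y : W (squash u v M y) <= W y.
  have := sum_move uv w (mrank_le u v M y); rewrite -!/(W _).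
  have : w v * (y u - mrank u v M y) <= w u * (y u - mrank u v M y).
    by rewrite leq_mul2r (ltnW wuv) orbT.
  rewrite /squash; lia.
have lt_W : W (squash u v M x) < W x.
  have := sum_move uv w (mrank_le u v M x); rewrite -!/(W _).
  (* If the rank of [x] were [x u], every smaller exponent of [u] would occur in its slice, among
     them [(x u).-1], against the choice of [x]. *)
  have : mrank u v M x < x u.
    rewrite ltn_neqAle mrank_le andbT; apply: contraNneq xN => e.
    by apply: (count_iota_full e); rewrite prednK.
  rewrite -subn_gt0 => h.
  have : w v * (x u - mrank u v M x) < w u * (x u - mrank u v M x).
    by rewrite ltn_mul2r h.
  rewrite /squash; lia.
have [||M' [h1 h2 h3]] := IH (compress u v M).
- rewrite -ltnS; apply: leq_trans ltn; rewrite ltnS.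
  rewrite (perm_big [seq squash u v M y | y <- M]) /=; last first.
    apply: uniq_perm; rewrite ?fset_uniq //.
      by rewrite map_inj_in_uniq ?fset_uniq //; exact: squash_inj.
    by move=> y; apply/imfsetP/mapP => -[z zM ->]; exists z.
  rewrite big_map 2!(big_rem x xM) /= -addSn; apply: leq_add => //.
  by apply: leq_sum => y _; exact: le_W.
- exact: multicomplex_compress.
by exists M'; split=> // i; rewrite h2 Fvec_compress.
Qed.

End Stable.

(** * Shellings and h-vectors *)

Section PureComplexes.
Variables (T : finType) (X : {set {set T}}) (e : nat).
Hypothesis X0 : X != set0.
Hypothesis Xe : forall A : {set T}, A \in X -> exists F : {set T}, [/\ F \in X, A \subset F & #|F| = e].

Lemma rk_pure : rk X = e.
Proof.
apply/eqP; rewrite eqn_leq; apply/andP; split.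
  by apply/bigmax_leqP => A /Xe[F [_ /subset_leq_card + <-]].
have /set0Pn[A /Xe[F [FX _ <-]]] := X0.
exact: leq_bigmax_cond.
Qed.

Lemma facets_pure : facets X = [set A in X | #|A| == e].
Proof.
apply/setP => A; rewrite !inE; apply/maxsetP/andP => [[AX Amax]|[AX /eqP Ae]].
  by split=> //; have [F [FX /(Amax F FX) <- ->]] := Xe AX.
split=> // B BX AB; apply/esym/eqP; rewrite eqEcard AB Ae.
by have [F [_ /subset_leq_card + <-]] := Xe BX.
Qed.

Lemma pure_pure : pure X.
Proof.
by move=> A; rewrite facets_pure !inE /face_dim /cdim rk_pure => /andP[_ /eqP ->].
Qed.

End PureComplexes.

Section IntervalSum.
Local Open Scope ring_scope.

(* The interval [R, F] of the Boolean lattice contributes x^|R| to the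
   h-polynomial: this is the expansion of a product over F of the factors
   x + (1 - x), those indexed by R being replaced by x. *)
Lemma interval_sum (T : finType) (K : comPzRingType) (x : K) (R F : {set T}) :
  R \subset F ->
  \sum_(A : {set T} | (R \subset A) && (A \subset F))
     x ^+ #|A| * (1 - x) ^+ (#|F| - #|A|) = x ^+ #|R|.
Proof.
move=> RF.
(* In the expansion, [A] picks [g] on its elements and [g'] elsewhere; a factor vanishes unless [A]
   lies between [R] and [F]. *)
pose g v := if v \in F then x else 0 : K.
pose g' v := if v \in R then 0 else if v \in F then 1 - x else 1 : K.
have -> : x ^+ #|R| = \prod_v (g v + g' v).
  rewrite (bigID (mem R)) /= [X in _ * X]big1 ?mulr1 => [|v vR]; last first.
    by rewrite /g /g' (negPf vR); case: ifP => _; rewrite ?add0r // addrC subrK.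
  rewrite (eq_bigr (fun=> x)) ?prodr_const // => v vR.
  by rewrite /g /g' vR (subsetP RF) // addr0.
rewrite bigA_distr [RHS](bigID (fun A : {set T} => (R \subset A) && (A \subset F))) /=.
rewrite [X in _ = _ + X]big1 ?addr0 => [|A]; last first.
  rewrite negb_and => /orP[/subsetPn[v vR vA]|/subsetPn[v vA vF]].
    by rewrite (bigD1 v) //= (negPf vA) /g' vR mul0r.
  by rewrite (bigD1 v) //= vA /g (negPf vF) mul0r.
apply: eq_bigr => A /andP[RA AF].
rewrite (bigID (mem A)) /=; congr (_ * _).
  rewrite (eq_bigr (fun=> x)) ?prodr_const // => v vA.
  by rewrite vA /g (subsetP AF).
rewrite -cardsDS // -prodr_const [RHS](bigID (mem F)) /= [X in _ = _ * X]big1 ?mulr1.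
  rewrite [RHS]big_mkcond [LHS]big_mkcond; apply: eq_bigr => v _; rewrite !inE.
  case h: (_ && _) => //; have /andP[vA vF] := h.
  by rewrite (negPf vA) /g' vF ifN //; apply: contra vA => /(subsetP RA).
move=> v /andP[vA vF]; rewrite (negPf vA) /g' (negPf vF) ifN //.
by apply: contra vF => /(subsetP RF).
Qed.

End IntervalSum.

Section Shelling.
Variables (T : finType) (d : nat) (tau : seq {set T}) (R : {set T} -> {set T}).
Hypothesis tau0 : 0 < size tau.
Hypothesis tau_card : forall F : {set T}, F \in tau -> #|F| = d.
Hypothesis R_sub : forall F : {set T}, F \in tau -> R F \subset F.
Hypothesis R_out : forall i j, j < i < size tau ->
  exists2 v, v \in R (nth set0 tau i) & v \notin nth set0 tau j.
Hypothesis R_exch : forall i v, i < size tau -> v \in R (nth set0 tau i) ->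
  exists2 j, j < i & nth set0 tau i :\ v \subset nth set0 tau j.

Definition generated := [set A : {set T} | has (fun F : {set T} => A \subset F) tau].

Let tau_ i := nth set0 tau i.
Let tau_mem i : i < size tau -> tau_ i \in tau := @mem_nth _ set0 tau i.

Lemma mem_generated F : F \in tau -> F \in generated.
Proof. by move=> Ft; rewrite inE; apply/hasP; exists F. Qed.

Lemma generated_complex : is_complex generated.
Proof.
split=> [|A B]; first by apply/set0Pn; exists (tau_ 0); exact/mem_generated/tau_mem.
rewrite !inE => /hasP[F Ft AF] BA; apply/hasP; exists F => //.
exact: subset_trans AF.
Qed.

Let generated_ne : generated != set0 := generated_complex.1.

Let generated_facet (A : {set T}) : A \in generated ->
  exists F : {set T}, [/\ F \in generated, A \subset F & #|F| = d].
Proof.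
rewrite inE => /hasP[F Ft AF]; exists F; split=> //; last exact: tau_card.
exact: mem_generated.
Qed.

Lemma rk_generated : rk generated = d.
Proof. exact: rk_pure generated_ne generated_facet. Qed.

Lemma facets_generated : tau =i facets generated.
Proof.
move=> F; rewrite (facets_pure generated_facet) inE.
apply/idP/andP => [Ft|]; first by rewrite mem_generated ?tau_card.
rewrite inE => -[/hasP[F' Ft' FF'] /eqP Fd].
suff -> : F = F' by exact: Ft'.
by apply/eqP; rewrite eqEcard FF' Fd (tau_card Ft') /=.
Qed.

Lemma shelling_uniq : uniq tau.
Proof.
apply/(uniqP set0) => i j; rewrite !inE => hi hj e.
case: (ltngtP i j) => // h.
  have [|v vR] := @R_out j i; first by rewrite h.
  by rewrite e (subsetP (R_sub (tau_mem hj))).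
have [|v vR] := @R_out i j; first by rewrite h.
by rewrite -e (subsetP (R_sub (tau_mem hi))).
Qed.

(** By [R_out], a face shared with an earlier facet misses some [v] of the restriction, so it lies
    in the facet less [v], which by [R_exch] is itself shared with an earlier facet. *)
Lemma generated_shellable : shellable generated.
Proof.
split; first exact: pure_pure generated_ne generated_facet.
exists tau; split; [exact: shelling_uniq|exact: facets_generated|].
move=> i /andP[i0 hi] D.
have inD (A : {set T}) j : j < i -> A \subset tau_ i -> A \subset tau_ j -> A \in D.
  move=> ji Ai Aj; rewrite !inE Ai; apply/bigcupP.
  by exists (Ordinal ji); rewrite ?inE.
have D0 : D != set0 by apply/set0Pn; exists set0; apply: (inD _ 0); rewrite ?sub0set.
have Dfacet (A : {set T}) : A \in D -> exists F : {set T}, [/\ F \in D, A \subset F & #|F| = d.-1].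
  rewrite !inE => /andP[Ai /bigcupP[[j ji] _]]; rewrite inE /= => Aj.
  have [|v vR vj] := @R_out i j; first by rewrite ji.
  have [j' j'i sub] := R_exch hi vR.
  have vi := subsetP (R_sub (tau_mem hi)) v vR.
  exists (tau_ i :\ v); split.
  - exact: inD j'i (subsetDl _ _) sub.
  - by rewrite subsetD1 Ai; apply: contra vj; apply: (subsetP Aj).
  by move: (cardsD1 v (tau_ i)); rewrite vi tau_card ?tau_mem // => ->.
split; first exact: pure_pure D0 Dfacet.
(* Without this [d.-1] would not be one less than [d]. *)
have d0 : 0 < d.
  have [|v vR _] := @R_out i 0; first by rewrite i0.
  rewrite -(tau_card (tau_mem hi)); apply/card_gt0P; exists v.
  exact: subsetP (R_sub (tau_mem hi)) v vR.
rewrite /cdim (rk_pure D0 Dfacet) rk_generated; lia.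
Qed.

Let first (A : {set T}) := find (fun F : {set T} => A \subset F) tau.

Let first_sub A : A \in generated -> A \subset tau_ (first A).
Proof. by rewrite inE => /(nth_find set0). Qed.

(** The intervals from [R F] to [F] partition the complex: a face of [F] missing some [v] in [R F]
    lies in an earlier facet by [R_exch], and one containing [R F] lies in none by [R_out]. *)
Lemma first_interval A i : i < size tau ->
  (A \in generated) && (first A == i) = (R (tau_ i) \subset A) && (A \subset tau_ i).
Proof.
move=> hi; apply/andP/andP => [[Ag /eqP fi]|[RA Ai]].
  have Ai : A \subset tau_ i.
    by rewrite -fi; exact: first_sub.
  split=> //; apply/subsetP => v vR; apply: contraT => vA.
  have [j ji sub] := R_exch hi vR.
  have := before_find set0 (_ : j < first A); rewrite fi => /(_ ji).
  by rewrite (subset_trans _ sub) // subsetD1 Ai.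
have Ag : A \in generated.
  by rewrite inE; apply/hasP; exists (tau_ i); rewrite ?tau_mem.
split=> //.
rewrite eqn_leq; apply/andP; split.
  by rewrite leqNgt; apply/negP => /(before_find set0); rewrite Ai.
rewrite leqNgt; apply/negP => h.
have [|v vR /negP[]] := @R_out i (first A); first by rewrite h.
by apply: (subsetP (first_sub Ag)); apply: (subsetP RA).
Qed.

(** Faces are grouped by the first facet containing them, and [interval_sum] evaluates each
    group. *)
Lemma hpoly_generated : hpoly generated = (\sum_(F <- tau) 'X^#|R F|)%R.
Proof.
rewrite /hpoly rk_generated.
pose g i : {poly int} := ('X^i * (1 - 'X) ^+ (d - i))%R.
transitivity (\sum_(A in generated) g #|A|)%R.
  transitivity (\sum_(i < d.+1) \sum_(A in generated | #|A| == i) g i)%R.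
    apply: eq_bigr => i _; rewrite scaler_nat sumr_const /fpred; congr (_ *+ _)%R.
    by rewrite cardsE.
  rewrite (exchange_big_dep (mem generated)) /=; last by move=> i A _ /andP[].
  apply: eq_bigr => A Ag.
  have hA : #|A| < d.+1.
    by have [F [_ /subset_leq_card + <-]] := generated_facet Ag.
  rewrite (big_pred1 (Ordinal hA)) // => i /=; rewrite Ag.
  by apply/eqP/eqP => [h|->//]; apply: val_inj.
rewrite [RHS](big_nth set0) big_mkord.
rewrite [RHS](eq_bigr (fun i : 'I_(size tau) =>
   \sum_(A in generated | first A == i) g #|A|)%R); last first.
  move=> i _; rewrite -(interval_sum 'X%R (R_sub (tau_mem (ltn_ord i)))).
  rewrite (tau_card (tau_mem (ltn_ord i))).
  by apply: eq_bigl => A; rewrite first_interval.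
rewrite (exchange_big_dep (mem generated)) /=; last by move=> i A _ /andP[].
apply: eq_bigr => A Ag.
have hA : first A < size tau by rewrite -has_find; move: Ag; rewrite inE.
rewrite (big_pred1 (Ordinal hA)) // => i /=; rewrite Ag.
by apply/eqP/eqP => [h|->//]; apply: val_inj.
Qed.

Lemma hvec_generated i : hvec generated i = Posz (count (fun F => #|R F| == i) tau).
Proof.
rewrite /hvec hpoly_generated coef_sum -sum1_count [in RHS]big_mkcond /=.
rewrite [RHS](big_morph Posz PoszD (erefl (Posz 0))).
by apply: eq_bigr => F _; rewrite coefXn eq_sym; case: eqP.
Qed.

End Shelling.

(** * Exchanges in the complement of a face *)

Section Labels.
Variables (T : finType) (r m : nat) (col : T -> option 'I_m).
Implicit Types (E : {set T}) (u v x : T) (q : 'I_(r + m)).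

Definition before u v := enum_rank u < enum_rank v.

Lemma before_trans : transitive before.
Proof. by move=> v u x; apply: ltn_trans. Qed.

Lemma before_irr v : before v v = false.
Proof. exact: ltnn. Qed.

Variant trichotomy u v : bool -> bool -> bool -> Prop :=
  | Before of before u v : trichotomy u v true false false
  | After of before v u : trichotomy u v false true false
  | Same of u = v : trichotomy u v false false true.

Lemma beforeP u v : trichotomy u v (before u v) (before v u) (u == v).
Proof.
rewrite /before; case: ltngtP => h.
- by rewrite (negPf (_ : u != v)); [constructor | apply: contraTneq h => ->; rewrite ltnn].
- by rewrite (negPf (_ : u != v)); [constructor | apply: contraTneq h => ->; rewrite ltnn].
by have -> := enum_rank_inj (val_inj h); rewrite eqxx; constructor.
Qed.

Lemma exists_first (P : pred T) x : P x ->
  exists2 v, P v & forall u, before u v -> ~~ P u.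
Proof.
move=> Px; case: (arg_minnP (fun v => enum_rank v : nat) Px) => v Pv vmin.
by exists v => // u; apply: contraL => /vmin; rewrite -leqNgt.
Qed.

Lemma exists_last (P : pred T) x : P x ->
  exists2 v, P v & forall u, before v u -> ~~ P u.
Proof.
move=> Px; case: (arg_maxnP (fun v => enum_rank v : nat) Px) => v Pv vmax.
by exists v => // u; apply: contraL => /vmax; rewrite -leqNgt.
Qed.

Definition agree v E E' := forall u, before u v -> (u \in E) = (u \in E').

Definition low E v :=
  (col v != None) && [forall u in E, before u v ==> (col u != col v)].

(** The low elements of [E] are the first ones in their colour classes. The others delimit the gaps,
    and this is the index of the gap of [v]. *)
Definition level E v := \sum_(u in E) (before u v && ~~ low E u).

(* The i-th bounded variable is rshift r i, the j-th unbounded one lshift m j.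
   For E the complement of a facet, v is labelled by the i-th bounded variable
   if it lies in the i-th colour class, not above the first element of E there;
   the other vertices are labelled by successive unbounded variables, a change
   occurring after each element of E, and None after the r-th of them.  So the
   label of v depends only on the elements of E before v. *)
Definition label E v : option 'I_(r + m) :=
  if low E v then omap (@rshift r m) (col v) else omap (@lshift r m) (insub (level E v)).

Lemma low_agree v E E' : agree v E E' -> low E v = low E' v.
Proof.
move=> h; rewrite /low; congr (_ && _).
by apply: eq_forallb => u; have := h u; case: (before u v) => [->|_] //; rewrite !implybT.
Qed.

Lemma agree_sub u v E E' : before u v -> agree v E E' -> agree u E E'.
Proof. by move=> uv h x xu; apply: h; apply: before_trans uv. Qed.

Lemma level_agree v E E' : agree v E E' -> level E v = level E' v.
Proof.
move=> h; rewrite /level big_mkcond [RHS]big_mkcond; apply: eq_bigr => u _.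
case uv: (before u v); last by rewrite !if_same.
by rewrite (h u uv) (low_agree (agree_sub uv h)).
Qed.

Lemma label_agree v E E' : agree v E E' -> label E v = label E' v.
Proof. by move=> h; rewrite /label (low_agree h) (level_agree h). Qed.

Lemma level_le E u v : before u v -> level E u <= level E v.
Proof.
move=> uv; apply: leq_sum => x _; case xu: (before x u) => //=.
by rewrite (before_trans xu uv).
Qed.

Lemma level_lt E u v : u \in E -> ~~ low E u -> before u v ->
  level E u < level E v.
Proof.
move=> uE nu uv; rewrite /level [ltnRHS](bigD1 u) //= uv nu /= add1n ltnS.
rewrite (bigD1 u) //= before_irr add0n; apply: leq_sum => x _.
by case xu: (before x u) => //=; rewrite (before_trans xu uv).
Qed.

Variant label_spec E v : option 'I_(r + m) -> bool -> Prop :=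
  | LabelLow i of low E v & col v = Some i : label_spec E v (Some (rshift r i)) true
  | LabelHigh (j : 'I_r) of ~~ low E v & level E v = j :
      label_spec E v (Some (lshift m j)) false
  | LabelNone of ~~ low E v & r <= level E v : label_spec E v None false.

Lemma labelP E v : label_spec E v (label E v) (low E v).
Proof.
rewrite /label; case: ifPn => lv.
  by have := lv; rewrite /low; case e: (col v) => [i|] //= _; constructor.
case: insubP => [j _ e|]; first exact: LabelHigh.
by rewrite -leqNgt; constructor.
Qed.

(** An element of [E] ends its label: if low, it stops later vertices of its colour from being low;
    otherwise it raises the level. *)
Lemma label_after E v u q : v \in E -> before v u -> label E v = Some q ->
  label E u != Some q.
Proof.
move=> vE vu; case: labelP => // [i _ ci|j nv lj] [<-]; apply/eqP.
  case: labelP => // [i' lu ci' /Some_inj/rshift_inj e|j _ _ /Some_inj/eqP].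
    move: lu => /andP[_ /forall_inP/(_ v vE)].
    by rewrite vu ci ci' e eqxx.
  by rewrite eq_lrshift.
case: labelP => // [i' lu ci' /Some_inj/eqP|j' _ lj' /Some_inj/lshift_inj e].
  by rewrite eq_rlshift.
by have := level_lt vE nv vu; rewrite lj lj' e ltnn.
Qed.

Lemma label_inj E u v q : u \in E -> v \in E ->
  label E u = Some q -> label E v = Some q -> u = v.
Proof.
move=> uE vE lu lv; case: (beforeP u v) => // h.
  by have := label_after uE h lu; rewrite lv eqxx.
by have := label_after vE h lv; rewrite lu eqxx.
Qed.

(** Labels are distinct on [E], so each of the [r + m] variables labels exactly one element; in
    particular [E] meets every colour class. *)
Definition good E := (#|E| == r + m) && [forall v in E, label E v != None].

Lemma card_label_le E : [forall v in E, label E v != None] ->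
  #|[set label E v | v in E]| = #|E|.
Proof.
move=> /forall_inP h; apply: card_in_imset => u v uE vE.
by have := h u uE; case e: (label E u) => [q|//] _ /esym; apply: label_inj e.
Qed.

Lemma label_codom E : [forall v in E, label E v != None] ->
  [set label E v | v in E] \subset [set Some q | q : 'I_(r + m)].
Proof.
move=> /forall_inP h; apply/subsetP => _ /imsetP[v vE ->].
by have := h v vE; case: label => // q _; apply: imset_f.
Qed.

Lemma card_Some k : #|[set Some q | q : 'I_k]| = k.
Proof. by rewrite card_imset ?card_ord // => ? ? []. Qed.

Lemma good_label E q : good E -> exists2 w, w \in E & label E w = Some q.
Proof.
move=> /andP[/eqP cE hE].
have : Some q \in [set label E v | v in E].
  have /eqP -> : [set label E v | v in E] == [set Some q | q : 'I_(r + m)].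
    by rewrite eqEcard label_codom // card_label_le // card_Some cE leqnn.
  exact: imset_f.
by case/imsetP => w wE ->; exists w.
Qed.

Lemma good_meets E i : good E -> exists2 w, w \in E & col w = Some i.
Proof.
move=> /(good_label (rshift r i))[w wE]; case: labelP => // [i' _ ci /Some_inj/rshift_inj <-|].
  by exists w.
by move=> j _ _ /Some_inj/eqP; rewrite eq_lrshift.
Qed.

(** The changes that stability tolerates: a variable stays, is deleted, or becomes an unbounded one,
    later than itself if it was unbounded. *)
Definition raises (a b : option 'I_(r + m)) :=
  a = b \/ exists2 q, a = Some q &
    (forall s, b = Some s -> exists2 j : 'I_r, s = lshift m j &
       forall j' : 'I_r, q = lshift m j' -> j' < j).

Section Exchange.
Variables (E : {set T}) (v w : T) (q : 'I_(r + m)).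
Hypotheses (hE : good E) (vE : v \notin E) (wE : w \in E).
Hypotheses (lv : label E v = Some q) (lw : label E w = Some q).

Let E' := v |: (E :\ w).

Lemma exchange_before : before v w.
Proof.
case: (beforeP v w) => // h; last by move: vE; rewrite h wE.
by have := label_after wE h lw; rewrite lv eqxx.
Qed.

Let vw := exchange_before.

Lemma mem_exchange x : x != v -> x != w -> (x \in E') = (x \in E).
Proof. by rewrite !inE => /negPf -> ->. Qed.

Lemma agree_exchange u : ~~ before v u -> agree u E' E.
Proof.
move=> vu x xu; apply: mem_exchange; first by apply: contraNneq vu => <-.
by apply: contraNneq vu => e; apply: before_trans vw _; rewrite -e.
Qed.

Lemma level_exchange u :
    (forall x, x \in E -> x != w -> low E' x = low E x) ->
  level E' u + (before w u && ~~ low E w) = level E u + (before v u && ~~ low E' v).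
Proof.
move=> h; rewrite /level [in LHS]big_setU1 ?inE ?(negPf vE) ?andbF //=.
rewrite [in RHS](big_setD1 w) //=.
rewrite (eq_bigr (fun x => (before x u && ~~ low E x) : nat)) => [|x].
  by rewrite addnAC [RHS]addnAC; congr addn; exact: addnC.
by rewrite !inE => /andP[xw xE]; rewrite h.
Qed.

Lemma label_exchange u : label E' u = label E u \/
  [/\ label E u = Some q, before v u & raises (label E u) (label E' u)].
Proof.
have [vu|nvu] := boolP (before v u); last by left; exact/label_agree/agree_exchange.
have lowv : low E' v = low E v.
  by apply/low_agree/agree_exchange; rewrite before_irr.
(* Bounded [q]: [w] is the first element of [E] in the class of [v]. Both are low, so levels stay;
   the vertices of the class after [v] and up to [w] exchange [q] for the variable of their level,
   or for [None]. *)
case lowE: (low E v).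
  have [i cv eq_q] : exists2 i, col v = Some i & q = rshift r i.
    move: lv lowE; case: labelP => // i _ cv [<-] _; by exists i.
  have [loww cw] : low E w /\ col w = Some i.
    move: lw; rewrite eq_q; case: labelP => [i' ? -> /Some_inj/rshift_inj -> //|j _ _|//].
    by move=> /Some_inj/eqP; rewrite eq_lrshift.
  have low_other x : col x != Some i -> low E' x = low E x.
    move=> cx; rewrite /low; congr (_ && _); apply: eq_forallb => y.
    have [->|yv] := eqVneq y v; first by rewrite cv eq_sym cx !implybT.
    have [->|yw] := eqVneq y w; first by rewrite cw eq_sym cx !implybT.
    by rewrite mem_exchange.
  have low_same x : before v x -> col x = Some i -> low E' x = false.
    move=> vx cx; apply/negP => /andP[_ /forall_inP/(_ v)].
    by rewrite !inE eqxx => /(_ isT); rewrite vx cv cx eqxx.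
  have lowE'E x : x \in E -> x != w -> low E' x = low E x.
    move=> xE xw; have [vx|] := boolP (before v x); last first.
      by move=> ?; apply/low_agree/agree_exchange.
    have [cx|] := eqVneq (col x) (Some i); last exact: low_other.
    rewrite low_same //; apply/esym/negP => lx.
    case/eqP: xw; apply: (@label_inj E _ _ q) => //.
    by rewrite /label lx cx eq_q.
  have lev : level E' u = level E u.
    by have := level_exchange u lowE'E; rewrite lowv lowE loww !andbF !addn0.
  have [cu|cu] := eqVneq (col u) (Some i); last first.
    by left; rewrite /label low_other // lev.
  case lowu: (low E u); last by left; rewrite /label lowu low_same // lev.
  have lu : label E u = Some q by rewrite /label lowu cu eq_q.
  right; split=> //; right; exists q => // s; rewrite /label low_same //.
  case: insub => //= j [<-]; exists j => // j'.
  by rewrite eq_q => /eqP; rewrite eq_rlshift.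
(* Unbounded [q]: lowness is unchanged, and levels rise by one after [v] and up to [w], so there [q]
   becomes the next unbounded variable, or [None]. *)
have [j eq_q lj] : exists2 j, q = lshift m j & level E v = j.
  move: lv lowE; case: labelP => // j _ ? [<-] _; by exists j.
have [loww lwj] : low E w = false /\ level E w = j.
  move: lw; rewrite eq_q; case: labelP => // [i _ _ /Some_inj/eqP|j' _ -> /Some_inj/lshift_inj -> //].
  by rewrite eq_rlshift.
(* If [v] or [w] has a colour, an earlier element of [E] has it too and already decides which later
   vertices are low. *)
have notlow E0 x y : low E0 x = false -> col x = col y -> col y != None ->
    before x y -> exists2 z, z \in E0 & [/\ before z x, col z = col x & before z y].
  rewrite /low => + cxy cy xy; rewrite cxy cy /= => /negbT/forall_inPn[z zE].
  rewrite negb_imply negbK => /andP[zx /eqP cz]; exists z => //; split=> //.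
  exact: before_trans xy.
have lowE'E x : low E' x = low E x.
  rewrite /low; case cx: (col x != None) => //=; apply/forall_inP/forall_inP => h y yE.
    have [e|yw] := eqVneq y w; last first.
      by apply: h; rewrite !inE yw yE orbT.
    apply/implyP => yx; apply/negP => /eqP cy; rewrite {y}e in yE yx cy.
    have [z zE [zw cz zx]] := notlow E w x loww cy cx yx.
    have : z \in E'.
      by rewrite !inE zE andbT orbC; apply/orP; left; apply: contraTneq zw => ->; rewrite before_irr.
    by move=> /h; rewrite zx cz cy eqxx.
  have [e|yv] := eqVneq y v; last first.
    by apply: h; move: yE; rewrite !inE (negPf yv) => /andP[].
  apply/implyP => yx; apply/negP => /eqP cy; rewrite {y yE}e in yx cy.
  have [z zE [zv cz zx]] := notlow E v x lowE cy cx yx.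
  by have := h z zE; rewrite zx cz cy eqxx.
have := level_exchange u (fun x _ _ => lowE'E x).
rewrite lowv lowE loww vu !andbT.
case wu: (before w u); first by move=> /addIn e; left; rewrite /label lowE'E e.
rewrite addn0 addn1 => e.
have [lowu|lowu] := boolP (low E u); first by left; rewrite /label lowE'E lowu.
have lu : level E u = j.
  apply/eqP; rewrite eqn_leq -{2}lj level_le // andbT -lwj.
  by move: wu; case: (beforeP w u) => // [/(@level_le E)|->].
have leu : label E u = Some q by rewrite /label (negPf lowu) lu eq_q valK.
right; split=> //; right; exists q => // s; rewrite /label lowE'E (negPf lowu) e lu.
case: insubP => //= j1 _ e1 [<-]; exists j1 => // j'.
by rewrite eq_q => /lshift_inj <-; rewrite e1.
Qed.

(** Only vertices labelled [q] change label, and [w] was the only one of these in [E]. *)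
Lemma good_exchange : good E'.
Proof.
have /andP[/eqP cE /forall_inP hE0] := hE.
rewrite /good cardsU1 !inE (negPf vE) andbF /=; apply/andP; split.
  by have := cardsD1 w E; rewrite wE cE add1n => <-.
apply/forall_inP => u; rewrite !inE => /orP[/eqP ->|/andP[uw uE]].
  by case: (label_exchange v) => [->|[_]]; rewrite ?lv // before_irr.
case: (label_exchange u) => [->|[lu _ _]]; first exact: hE0.
by case/eqP: uw; apply: label_inj lu lw.
Qed.

Lemma raises_exchange u : raises (label E u) (label E' u).
Proof. by case: (label_exchange u) => [->|[]//]; left. Qed.

End Exchange.

End Labels.

(** * The bijection between faces and monomials *)

Section Monomials.
Variable k : nat.
Implicit Types (s : seq (option 'I_k)) (q : 'I_k).

(** The product of the listed variables, [None] standing for 1; a list allows labels to be changed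
    one at a time. *)
Definition mnm_of s : 'X_{1..k} := [multinom count_mem (Some q) s | q < k].

Lemma mnm_ofE s q : mnm_of s q = count_mem (Some q) s.
Proof. exact: mnmE. Qed.

Lemma mnm_of_perm s s' : perm_eq s s' -> mnm_of s = mnm_of s'.
Proof. by move=> /permP h; apply/mnmP => q; rewrite !mnm_ofE h. Qed.

Lemma mdeg_mnm_of s : mdeg (mnm_of s) = count isSome s.
Proof.
rewrite mdegE; under eq_bigr do rewrite mnm_ofE.
elim: s => [|a s IH] /=; first by rewrite big1.
rewrite big_split /= IH; congr addn.
case: a => [q|]; last by rewrite big1.
rewrite (bigD1 q) //= eqxx big1 ?addn0 // => q' h.
by apply/eqP; rewrite eqb0; apply: contra h => /eqP[->].
Qed.

End Monomials.

Section Encoding.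
Variables (T : finType) (r m : nat) (col : T -> option 'I_m).
Implicit Types (E : {set T}) (u v w : T) (q : 'I_(r + m)).

Local Notation label := (@label T r m col).
Local Notation good := (@good T r m col).

Definition mon E := mnm_of [seq label E v | v <- enum (~: E)].

Lemma monE E q : mon E q = #|[set v | (v \notin E) && (label E v == Some q)]|.
Proof.
rewrite mnm_ofE count_map -sum1_count big_enum_cond /= sum1dep_card.
by apply: eq_card => v; rewrite !inE.
Qed.

Lemma mdeg_mon E : mdeg (mon E) = #|[set v in ~: E | label E v != None]|.
Proof.
rewrite mdeg_mnm_of count_map -sum1_count big_enum_cond /= sum1dep_card.
by apply: eq_card => v; rewrite !inE; case: label.
Qed.

(** For [E'] the label [q] ends at [v], so all that is counted comes before [v] and is counted for
    [E] as well, together with [v]. *)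
Lemma mon_lt E E' v q : agree v E E' -> v \in E' -> v \notin E ->
  label E' v = Some q -> mon E' q < mon E q.
Proof.
move=> h vE' vE lv; rewrite !monE; apply: proper_card; apply/properP; split.
  apply/subsetP => u; rewrite !inE => /andP[uE' lu].
  have uv : before u v.
    case: (beforeP u v) lu => // [vu|uv].
      by rewrite (negPf (label_after vE' vu lv)).
    by rewrite uv vE' in uE'.
  by rewrite (h u uv) uE' (label_agree _ _ (agree_sub uv h)).
by exists v; rewrite !inE ?vE' // vE (label_agree _ _ h) lv eqxx.
Qed.

Lemma first_difference E E' : E != E' -> exists v,
  agree v E E' /\ ((v \in E) != (v \in E')).
Proof.
move=> ne; have [v vP|h] := pickP (fun v => (v \in E) != (v \in E')); last first.
  by case/eqP: ne; apply/setP => v; apply/eqP; rewrite -[_ == _]negbK h.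
have [u uP umin] := @exists_first _ (fun v => (v \in E) != (v \in E')) v vP.
by exists u; split=> // x /umin; rewrite negbK => /eqP.
Qed.

Lemma mon_inj E E' : good E -> good E' -> mon E = mon E' -> E = E'.
Proof.
move=> /andP[_ /forall_inP g] /andP[_ /forall_inP g'] e; apply/eqP.
apply: contraT => /first_difference[v [h]].
case vE: (v \in E); case vE': (v \in E') => // _.
  have := g v vE; case lv: label => [q|//] _.
  have h' : agree v E' E by move=> u /h.
  by have := mon_lt h' vE (negbT vE') lv; rewrite e ltnn.
have := g' v vE'; case lv: label => [q|//] _.
by have := mon_lt h vE' (negbT vE) lv; rewrite e ltnn.
Qed.

Section Surjectivity.
Variable x : 'X_{1..r + m}.
Hypothesis x_bound : forall i, x (rshift r i) < #|[set v | col v == Some i]|.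
Hypothesis x_deg : mdeg x + (r + m) <= #|T|.

Definition earlier E v q :=
  [set u | [&& before u v, u \notin E & label E u == Some q]].

(** Greedy rule: [v] enters [E] once the earlier vertices outside [E] with its label reach the
    wanted exponent. *)
Definition closes E v : bool :=
  if label E v is Some q then x q <= #|earlier E v q| else false.

Lemma closes_agree E E' v : agree v E E' -> closes E v = closes E' v.
Proof.
move=> h; rewrite /closes (label_agree _ _ h); case: label => // q.
congr (_ <= _); apply: eq_card => u; rewrite !inE.
by case uv: (before u v); rewrite //= (h u uv) (label_agree _ _ (agree_sub uv h)).
Qed.

Lemma exists_greedy : exists E, forall v, (v \in E) = closes E v.
Proof.
suff h n : exists E, forall v, enum_rank v < n -> (v \in E) = closes E v.
  by have [E hE] := h #|T|; exists E => v; apply: hE.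
elim: n => [|n [E hE]]; first by exists set0.
exists [set v | if (enum_rank v < n) then v \in E else closes E v] => v vn.
set E' := [set _ | _].
have h : agree v E E'.
  move=> u; rewrite /before => uv; rewrite inE; case: ifPn => // /negP[].
  by apply: leq_trans uv _; rewrite -ltnS.
by rewrite inE -(closes_agree h); case: ifP => // /hE.
Qed.

(** For the greedy [E], no exponent exceeds that of [x], with equality for each label used in [E];
    it remains to see that [E] has [r + m] elements. *)
Lemma mon_surj : exists2 E, good E & mon E = x.
Proof.
have [E hE] := exists_greedy.
have lab v : v \in E -> label E v != None.
  by rewrite hE /closes; case: label.
have labE : [forall v in E, label E v != None] by apply/forall_inP.
have mon_le q : mon E q <= x q.
  rewrite leqNgt; apply/negP => lt.
  have : 0 < mon E q by exact: leq_trans lt.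
  rewrite monE => /card_gt0P[u0]; rewrite inE => u0P.
  (* Before the last vertex counted for [q] the exponent is already reached, so the rule would have
     put that vertex into [E]. *)
  have [u /andP[uE /eqP lu] umax] :=
    @exists_last _ (fun u => (u \notin E) && (label E u == Some q)) u0 u0P.
  case/negP: uE; rewrite hE /closes lu -ltnS (leq_trans lt) // monE.
  rewrite (cardsD1 u) -[leqRHS]add1n leq_add ?leq_b1 //.
  apply: subset_leq_card; apply/subsetP => v.
  rewrite !inE => /andP[vu vP]; rewrite vP andbT.
  by case: (beforeP v u) vu => // /umax; rewrite vP.
have le_mon w q : w \in E -> label E w = Some q -> x q <= mon E q.
  rewrite hE /closes => + lw; rewrite lw => /leq_trans; apply.
  rewrite monE; apply: subset_leq_card; apply/subsetP => u.
  by rewrite !inE => /andP[].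
have low_ex i : exists2 w, w \in E & low col E w && (col w == Some i).
  have [w0 /andP[w0E c0]|none] := pickP (fun w => (w \in E) && (col w == Some i)).
    have [|w /andP[wE cw] wmin] :=
      @exists_first _ (fun w => (w \in E) && (col w == Some i)) w0; first by rewrite w0E.
    exists w => //; rewrite cw andbT /low (eqP cw); apply/forall_inP => u uE.
    by apply/implyP => /wmin; rewrite uE.
  (* If [E] missed class [i], the whole class would be counted for this variable, against
     [x_bound]. *)
  have := x_bound i; rewrite ltnNge => /negP[]; apply: leq_trans (mon_le _).
  rewrite monE; apply: subset_leq_card; apply/subsetP => v; rewrite !inE => cv.
  have lv : low col E v.
    rewrite /low (eqP cv); apply/forall_inP => u uE.
    by have := none u; rewrite uE /= => ->; rewrite implybT.
  have -> /= : v \notin E by have := none v; rewrite cv andbT => ->.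
  by rewrite /label lv (eqP cv).
have leE : #|E| <= r + m.
  by rewrite -(card_label_le labE) -[leqRHS]card_Some subset_leq_card // label_codom.
have cardE : #|E| = r + m.
  (* [E] has at least [m] low elements. If it were too small, fewer than [r] would be left, so every
     vertex would be labelled and the degree of [mon E] would exceed that of [x]. *)
  apply/eqP; rewrite eqn_leq leE leqNgt; apply/negP => ltE.
  pose L := [set w in E | low col E w].
  have mL : m <= #|L|.
    apply: leq_trans (leq_imset_card col L); rewrite -[leqLHS]card_Some.
    apply: subset_leq_card; apply/subsetP => _ /imsetP[i _ ->].
    have [w wE /andP[lw /eqP <-]] := low_ex i.
    by apply: imset_f; rewrite inE wE.
  have lev v : level col E v < r.
    have : level col E v <= #|E :\: L|.
      rewrite /level -sum1_card big_mkcond [leqRHS]big_mkcond; apply: leq_sum => u _.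
      by rewrite !inE; case: (u \in E) => //=; rewrite andbT; case: low; case: before.
    have : #|E :\: L| + #|L| = #|E|.
      rewrite addnC -(cardsID L E); congr (_ + _); apply: eq_card => u.
      by rewrite !inE andbA andbb.
    lia.
  have : #|~: E| <= mdeg (mon E).
    rewrite mdeg_mon; apply: subset_leq_card; apply/subsetP => v; rewrite !inE => ->.
    by case: labelP => // _; rewrite leqNgt lev.
  have : mdeg (mon E) <= mdeg x by rewrite !mdegE leq_sum.
  have := cardsC E; lia.
have gE : good E by rewrite /good cardE eqxx.
exists E => //; apply/mnmP => q; apply/eqP; rewrite eqn_leq mon_le /=.
by have [w wE /le_mon] := good_label q gE; apply.
Qed.

End Surjectivity.
End Encoding.

(** * The shelling of a stable multicomplex *)

Section Raising.
Variables (r m : nat) (b : 'I_m -> nat).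
Implicit Types (s t : seq (option 'I_(r + m))) (q : 'I_(r + m)).

(** Unbounded variables get lighter as their index grows, and bounded ones are heaviest, so that
    [raises] only makes admissible replacements. *)
Definition weight q : nat := match split q with inl j => r - j | inr _ => r.+1 end.

Lemma admissible_lshift q (j : 'I_r) :
  (forall j' : 'I_r, q = lshift m j' -> j' < j) ->
  admissible (inf_then b) weight q (lshift m j).
Proof.
move=> h; rewrite /admissible /inf_then /weight.
rewrite -[lshift m j]/(unsplit (inl j)) unsplitK eqxx /=.
have := ltn_ord j; case: splitP => [j' e|i _]; last lia.
have := h j' (ord_inj (e : q = lshift m j' :> nat)); lia.
Qed.

Variable M : {fset 'X_{1..r + m}}.
Hypotheses (hM : multicomplex (inf_then b) M) (stM : stable (inf_then b) weight M).

Lemma mnm_of_raise1 x y s :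
  raises x y -> mnm_of (x :: s) \in M -> mnm_of (y :: s) \in M.
Proof.
have [_ _ down] := hM.
case=> [->//|[q ->{x}]]; case: y => [z|_]; last first.
  by move/down; apply; apply/mnm_lepP => q'; rewrite !mnm_ofE /= leq_addl.
case/(_ z erefl) => j -> /admissible_lshift adm xM.
have qj : q != lshift m j by apply: contraTneq adm => ->; rewrite /admissible ltnn andbF.
have := stM adm xM; rewrite mnm_ofE /= eqxx add1n => /(_ isT).
congr (_ \in M); apply: (mnm_eq_uv (u := q) (v := lshift m j)) => [||z' z'q z'j].
- by rewrite move_u mnm_ofE /= eq_sym (inj_eq Some_inj) (negPf qj).
- rewrite move_v // !mnm_ofE /= !(inj_eq Some_inj) !eqxx (negPf qj); lia.
rewrite move_out // !mnm_ofE /= !(inj_eq Some_inj).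
by rewrite ![_ == z']eq_sym (negPf z'q) (negPf z'j).
Qed.

(** Entries are changed one by one; [t] collects those already changed. *)
Lemma mnm_of_raise (I : Type) (f g : I -> option 'I_(r + m)) (s : seq I) t :
  (forall x, raises (f x) (g x)) ->
  mnm_of (map f s ++ t) \in M -> mnm_of (map g s ++ t) \in M.
Proof.
move=> h; elim: s t => [|x s IH] t //= /(mnm_of_raise1 (h x)) xM.
rewrite (@mnm_of_perm _ _ (map g s ++ g x :: t)); last first.
  by rewrite -(cat1s (g x) t) -cat1s perm_catCA.
apply: IH; rewrite (@mnm_of_perm _ _ (g x :: map f s ++ t)) //.
by rewrite -(cat1s (g x) t) -(cat1s (g x) (_ ++ _)) perm_catCA.
Qed.

Variables (T : finType) (col : T -> option 'I_m).

(** In the complement [w] takes the place of [v]. As both have label [q] under [E], the monomial is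
    unaffected until the labels are raised. *)
Lemma mon_exchange (E : {set T}) v w q :
    v \notin E -> w \in E ->
    label r col E v = Some q -> label r col E w = Some q ->
  mon r col E \in M -> mon r col (v |: (E :\ w)) \in M.
Proof.
move=> vE wE lv lw.
have vw : v != w by apply: contraNneq vE => ->.
set E' := _ |: _; rewrite /mon.
have p1 : perm_eq (enum (~: E)) (v :: enum (~: E :\ v)).
  apply: uniq_perm; rewrite ?enum_uniq //=.
    by rewrite enum_uniq mem_enum !inE eqxx.
  by move=> u; rewrite in_cons !mem_enum !inE; case: eqVneq => // ->.
have p2 : perm_eq (enum (~: E')) (w :: enum (~: E :\ v)).
  apply: uniq_perm; rewrite ?enum_uniq //=.
    by rewrite enum_uniq mem_enum !inE wE andbF.
  move=> u; rewrite in_cons !mem_enum !inE negb_or negb_and negbK.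
  by have [->|] := eqVneq u w; rewrite /= ?andbT // eq_sym.
rewrite (mnm_of_perm (perm_map _ p1)) (mnm_of_perm (perm_map _ p2)) /=.
have := @mnm_of_raise T (label r col E) (label r col E') (w :: enum (~: E :\ v)) [::].
rewrite !cats0 /= lw lv; apply=> u.
exact: raises_exchange vE wE lv lw u.
Qed.

End Raising.

Section Construction.
Variables (T : finType) (d r m : nat) (b : 'I_m -> nat) (col : T -> option 'I_m).
Variable M : {fset 'X_{1..r + m}}.
Hypotheses (hM : multicomplex (inf_then b) M).
Hypothesis stM : stable (inf_then b) (@weight r m) M.
Hypothesis b_lt : forall i, b i < #|[set v | col v == Some i]|.
Hypothesis card_T : #|T| = d + (r + m).
Hypothesis deg_le : forall x, x \in M -> mdeg x <= d.

Local Notation good := (@good T r m col).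
Local Notation mon := (@mon T r m col).
Local Notation label := (@label T r m col).

Definition fits (F : {set T}) := good (~: F) && (mon (~: F) \in M).

Definition restriction (F : {set T}) := [set v in F | label (~: F) v != None].

(** The indicator of [F]: at the first difference, the set containing the vertex is the larger. *)
Definition key (F : {set T}) : #|T|.-tuplelexi bool :=
  [tuple enum_val i \in F | i < #|T|].

Lemma key_lt F F' v : agree v F F' -> v \notin F -> v \in F' ->
  (key F < key F')%O.
Proof.
move=> h vF vF'; apply/Order.TupleLexiOrder.Exports.ltxi_tuplePlt.
exists (enum_rank v) => [i iv|]; rewrite !tnth_mktuple.
  by apply: h; rewrite /before enum_valK.
by rewrite enum_rankK (negPf vF) vF'.
Qed.

Lemma key_ltP F F' : (key F < key F')%O ->
  exists v, [/\ agree v F F', v \notin F & v \in F'].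
Proof.
case/Order.TupleLexiOrder.Exports.ltxi_tuplePlt => i h.
rewrite !tnth_mktuple => lt; exists (enum_val i); split.
- move=> u; rewrite /before enum_valK => /h.
  by rewrite !tnth_mktuple enum_rankK.
- by move: lt; case: (_ \in F); case: (_ \in F').
by move: lt; case: (_ \in F); case: (_ \in F').
Qed.

Lemma key_inj : injective key.
Proof.
move=> F F' e; apply/setP => v.
have /(congr1 (fun t => tnth t (enum_rank v))) := e.
by rewrite !tnth_mktuple enum_rankK.
Qed.

Definition facet_seq : seq {set T} :=
  sort (fun F F' => key F <= key F')%O (enum [set F | fits F]).

Lemma mem_facet_seq F : (F \in facet_seq) = fits F.
Proof. by rewrite mem_sort mem_enum inE. Qed.

Lemma facet_seq_uniq : uniq facet_seq.
Proof. by rewrite sort_uniq enum_uniq. Qed.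

Lemma facet_seq_sorted i j : i < size facet_seq -> j < size facet_seq ->
  (key (nth set0 facet_seq i) < key (nth set0 facet_seq j))%O = (i < j).
Proof.
have le_nth i' j' : i' < size facet_seq -> j' < size facet_seq -> i' <= j' ->
    (key (nth set0 facet_seq i') <= key (nth set0 facet_seq j'))%O.
  move=> hi hj.
  apply: (@sorted_leq_nth _ (fun F F' => key F <= key F')%O _ _ set0) => //.
  - by move=> ? ? ?; exact: Order.POrderTheory.le_trans.
  - by apply: sort_sorted => F F'; exact: Order.TotalTheory.le_total.
move=> hi hj; case: ltnP => ij; last first.
  by apply/negbTE; rewrite -Order.TotalTheory.leNgt le_nth.
rewrite Order.POrderTheory.lt_neqAle le_nth ?(ltnW ij) // andbT.
by rewrite (inj_eq key_inj) nth_uniq ?facet_seq_uniq // neq_ltn ij.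
Qed.

Lemma card_fits F : fits F -> #|F| = d.
Proof.
by case/andP=> /andP[/eqP h _] _; have := cardsC F; rewrite h card_T => /addIn.
Qed.

Lemma exists_fits x : x \in M -> exists2 F, fits F & mon (~: F) = x.
Proof.
move=> xM; have [_ bM _] := hM.
have [||E gE eE] := @mon_surj T r m col x.
- move=> i; apply: leq_ltn_trans (b_lt i).
  have /forallP/(_ (rshift r i)) := bM x xM.
  by rewrite /inf_then -[rshift r i]/(unsplit (inr i)) unsplitK.
- by rewrite card_T leq_add2r deg_le.
by exists (~: E); rewrite /fits setCK ?gE eE ?xM.
Qed.

(** At the first difference [v], both complements give [v] the same label, and it is not [None]
    because [v] belongs to the good complement of the earlier facet. *)
Lemma facet_seq_out i j : j < i < size facet_seq ->
  exists2 v, v \in restriction (nth set0 facet_seq i) & v \notin nth set0 facet_seq j.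
Proof.
move=> /andP[ji hi]; have hj := ltn_trans ji hi.
have := facet_seq_sorted hj hi; rewrite ji => /key_ltP[v [h vj vi]].
exists v => //; rewrite inE vi /=.
have h' : agree v (~: nth set0 facet_seq i) (~: nth set0 facet_seq j).
  by move=> u uv; rewrite !inE h.
rewrite (label_agree _ _ h').
have : fits (nth set0 facet_seq j) by rewrite -mem_facet_seq mem_nth.
by case/andP=> /andP[_ /forall_inP g] _; apply: g; rewrite inE.
Qed.

Lemma facet_seq_exch i v : i < size facet_seq ->
    v \in restriction (nth set0 facet_seq i) ->
  exists2 j, j < i & nth set0 facet_seq i :\ v \subset nth set0 facet_seq j.
Proof.
move=> hi; set F := nth _ _ i; rewrite inE => /andP[vF lvN].
have /andP[gF mF] : fits F by rewrite -mem_facet_seq mem_nth.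
case lv: (label (~: F) v) lvN => [q|//] _.
have [w wF lw] := good_label q gF.
have vE : v \notin ~: F by rewrite inE negbK.
(* [v] comes before [w], so it is the first difference between [F] and [F']; as [F'] lacks it, [F']
   comes earlier. *)
pose E' := v |: (~: F :\ w); pose F' := ~: E'.
have fF' : F' \in facet_seq.
  rewrite mem_facet_seq /fits setCK (good_exchange gF vE wF lv lw) /=.
  exact: (mon_exchange hM stM vE wF lv lw mF).
have hj : index F' facet_seq < size facet_seq by rewrite index_mem.
exists (index F' facet_seq).
  rewrite -facet_seq_sorted // nth_index //; apply: (@key_lt _ _ v) => //.
    move=> u uv; rewrite inE (agree_exchange vE wF lv lw _ uv) ?before_irr //.
    by rewrite inE negbK.
  by rewrite !inE eqxx.
rewrite nth_index //; apply/subsetP => u; rewrite !inE => /andP[uv uF].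
by rewrite (negPf uv) uF andbF.
Qed.

(** The facets correspond bijectively to [M], the size of the restriction being the degree of the
    monomial. *)
Lemma count_facet_seq i : count (fun F => #|restriction F| == i) facet_seq = Fvec M i.
Proof.
have cR F : #|restriction F| = mdeg (mon (~: F)) by rewrite mdeg_mon setCK.
rewrite -size_filter -(size_map (fun F => mon (~: F))) /Fvec.
apply/perm_size/uniq_perm; rewrite ?fset_uniq //.
  rewrite map_inj_in_uniq ?filter_uniq ?facet_seq_uniq // => F F'.
  rewrite !mem_filter !mem_facet_seq => /andP[_ /andP[g _]] /andP[_ /andP[g' _]] e.
  exact/setC_inj/(mon_inj g g' e).
move=> x; rewrite !inE /=; apply/mapP/andP => [[F]|[xM /eqP xi]].
  by rewrite mem_filter mem_facet_seq cR => /andP[/eqP <- /andP[_ mF]] ->.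
have [F fF eF] := exists_fits xM; exists F => //.
by rewrite mem_filter mem_facet_seq cR eF xi eqxx.
Qed.

Lemma shellable_of_stable : exists G : {set {set T}},
  [/\ is_complex G, rk G = d, shellable G,
      (forall A i, A \in G -> ~~ ([set v | col v == Some i] \subset A))
    & forall i, hvec G i = Posz (Fvec M i)].
Proof.
have s0 : 0 < size facet_seq.
  have [/fset0Pn[x xM] _ _] := hM; have [F fF _] := exists_fits xM.
  by have := fF; rewrite -mem_facet_seq; case: facet_seq.
have cF F : F \in facet_seq -> #|F| = d by rewrite mem_facet_seq => /card_fits.
have sR F : F \in facet_seq -> restriction F \subset F.
  by move=> _; apply/subsetP => v; rewrite inE => /andP[].
exists (generated facet_seq); split.
- exact: generated_complex.
- exact: rk_generated.
- exact: generated_shellable s0 cF sR facet_seq_out facet_seq_exch.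
- move=> A i; rewrite inE => /hasP[F]; rewrite mem_facet_seq => /andP[gF _] AF.
  have [w wF cw] := good_meets i gF; apply/subsetPn; exists w; first by rewrite inE cw.
  by apply: contraTN wF => /(subsetP AF); rewrite inE negbK.
move=> i; rewrite (hvec_generated s0 cF sR facet_seq_out facet_seq_exch).
by rewrite count_facet_seq.
Qed.

End Construction.

(** * The shellable complex inside [Lambda], the sets [Pset] being the colour classes *)

Theorem theorem1p2 (l m n d : nat) (p : 'I_m -> nat)
    (hl : 1 <= l) (hp : forall i, 2 <= p i)
    (hn : n = l + \sum_(i < m) p i) (hd : d <= n - m)
    (M : {fset 'X_{1..(n - d - m) + m}})
    (hM : multicomplex (@inf_then (n - d - m) m (fun i => p i - 1)) M)
    (hdeg : deg M <= d) :
  exists G : {set {set vertex l p}},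
    [/\ is_complex G /\ G \subset Lambda l p,
        cdim G = (d%:Z - 1)%R,
        shellable G,
        (forall i, i <= d -> hvec G i = ((Fvec M i)%:Z)%R)
      & (forall i, d < i -> Fvec M i = 0)].
Proof.
have Fvec0 i : d < i -> Fvec M i = 0.
  move=> di; apply/eqP; rewrite cardfs_eq0; apply/eqP/fsetP => x.
  rewrite !inE /=; apply/negP => /andP[xM /eqP e].
  have : mdeg x <= deg M by rewrite /deg (big_rem x xM) /= leq_maxl.
  by rewrite e leqNgt (leq_ltn_trans hdeg di).
have [M' [hM' FM' stM']] := exists_stable (@weight (n - d - m) m) hM.
pose col (v : vertex l p) : option 'I_m :=
  if v is inr u then Some (tag u) else None.
have PsetE i : Pset l p i = [set v | col v == Some i].
  by apply/setP => -[x|u]; rewrite !inE.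
have card_T : #|{: vertex l p}| = d + (n - d - m + m).
  have -> : #|{: vertex l p}| = n.
    rewrite card_sum card_ord card_tagged sumnE big_map big_enum hn.
    by congr addn; apply: eq_bigr => i _; rewrite card_ord.
  (* With [hd] this makes the truncated subtractions in [n - d - m] exact. *)
  have : m <= n.
    rewrite hn -{1}(card_ord m) -sum1_card.
    by apply: leq_trans (leq_addl _ _); apply: leq_sum => i _; exact: ltnW.
  lia.
have b_lt i : p i - 1 < #|[set v | col v == Some i]|.
  by rewrite -PsetE card_Pset; have := hp i; lia.
(* The degree bound passes to [M'] through the common F-vector. *)
have deg_le x : x \in M' -> mdeg x <= d.
  move=> xM; rewrite leqNgt; apply/negP => /Fvec0; rewrite -FM' => /eqP.
  by rewrite cardfs_eq0 => /eqP/fsetP/(_ x); rewrite !inE /= xM eqxx.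
have [G [cG rG sG nG hG]] := shellable_of_stable hM' stM' b_lt card_T deg_le.
exists G; split=> //; last by move=> i _; rewrite hG FM'.
- split=> //; apply/subsetP => A AG; rewrite LambdaE; apply/forallP => i.
  by rewrite PsetE nG.
- by rewrite /cdim rG.
Qed.
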